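(* Let $\mathcal{X}$ be an infinite dimensional complex Banach space and $X\in B(\mathcal{X})$. Let $\mathbb{A},\mathbb{B},\mathbb{S},\mathbb{T}$ be commuting $d$-tuples in $B(\mathcal{X})^d$ such that $$[\mathbb{A},\mathbb{S}]=[\mathbb{B},\mathbb{S}]=[\mathbb{B},\mathbb{T}]=0.$$ If $$\triangle^m_{\mathbb{A},\mathbb{B}}\big(\delta^n_{\mathbb{A},\mathbb{B}}(X)\big)=0=\triangle^r_{\mathbb{S},\mathbb{T}}\big(\delta^s_{\mathbb{S},\mathbb{T}}(X)\big)$$ and $$\triangle^r_{\mathbb{S},\mathbb{T}}\big(\delta^n_{\mathbb{A},\mathbb{B}}(X)\big)=0=\triangle^m_{\mathbb{A},\mathbb{B}}\big(\delta^s_{\mathbb{S},\mathbb{T}}(X)\big)$$ for some positive integers $m,n,r$ and $s$, then $$\triangle^{t_1}_{\mathbb{S}\mathbb{A},\mathbb{T}\mathbb{B}}\big(\delta^{t_2}_{\mathbb{S}\mathbb{A},\mathbb{T}\mathbb{B}}(X)\big)=0,$$ where $t_1=m+r-1$ and $t_2=n+s-1$.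
   Context: $B(\mathcal{X})$ is the algebra of bounded linear operators on $\mathcal{X}$; $d\ge1$ is an integer. A tuple $(A_1,\dots,A_k)$ is commuting if $A_iA_j=A_jA_i$ for all $i,j$. For tuples $\mathbb{A},\mathbb{S}$, $[\mathbb{A},\mathbb{S}]=0$ means $A_iS_j=S_jA_i$ for all $i,j$. For commuting $k$-tuples $\mathbb{A},\mathbb{B}$ in $B(\mathcal{X})^k$ ($k\geq 1$) define linear operators on $B(\mathcal{X})$ by $$\triangle_{\mathbb{A},\mathbb{B}}(X)=X-\sum_{i=1}^k A_iXB_i,\qquad \delta_{\mathbb{A},\mathbb{B}}(X)=\Big(\sum_{i=1}^k A_i\Big)X-X\Big(\sum_{i=1}^k B_i\Big),$$ with powers meaning iterates. The product of $d$-tuples $\mathbb{S}$ and $\mathbb{A}$ is the $d^2$-tuple $$\mathbb{S}\mathbb{A}=(S_1A_1,\dots,S_1A_d,S_2A_1,\dots,S_2A_d,\dots,S_dA_1,\dots,S_dA_d),$$ and similarly $\mathbb{T}\mathbb{B}$ (entries $T_jB_i$ in the same order). *)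

(* Defs.v *)
From HB Require Import structures.
From mathcomp Require Import all_boot all_order all_algebra.
From mathcomp Require Export complex.
From mathcomp Require Import boolp classical_sets functions reals topology.
From mathcomp Require Import normedtype.

Set Implicit Arguments.
Unset Strict Implicit.
Unset Printing Implicit Defensive.

Import Order.TTheory GRing.Theory Num.Theory.

Local Open Scope ring_scope.

Section BoundedOperators.
Context (K : numFieldType) (V : normedModType K).

Definition bounded_linear (f : V -> V) : Prop :=
  linear f /\ exists M : K, forall x : V, `|f x| <= M * `|x|.

Definition bounded_linear_pred : {pred V -> V} :=
  fun f => `[< bounded_linear f >].

Record bop := Bop {
  bop_fun :> V -> V;
  bop_funP : bop_fun \in bounded_linear_pred }.

HB.instance Definition _ := [isSub for bop_fun].
HB.instance Definition _ := [Choice of bop by <:].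

Lemma bopP (f : bop) : bounded_linear f.
Proof. exact/asboolP/bop_funP. Qed.

Lemma bopD (f : bop) : {morph f : x y / x + y}.
Proof. by move=> x y; have := (bopP f).1 1 x y; rewrite !scale1r. Qed.

Lemma bop_ext (f g : bop) : f =1 g -> f = g.
Proof. by move=> fg; apply/val_inj/funext. Qed.

Lemma bounded_linear_zmod_closed : zmod_closed bounded_linear_pred.
Proof.
split=> [|f g /asboolP[lf [M fM]] /asboolP[lg [N gN]]]; apply/asboolP; split.
- by move=> a x y; change (0 = a *: 0 + 0 :> V); rewrite scaler0 addr0.
- by exists 0 => x; change (`|0 : V| <= 0 * `|x|); rewrite normr0 mul0r.
- move=> a x y.
  change (f (a *: x + y) - g (a *: x + y) = a *: (f x - g x) + (f y - g y)).
  by rewrite lf lg scalerBr opprD addrACA.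
- exists (M + N) => x; change (`|f x - g x| <= (M + N) * `|x|).
  rewrite mulrDl.
  by apply: le_trans (ler_normB _ _) _; apply: lerD.
Qed.

HB.instance Definition _ :=
  GRing.isZmodClosed.Build (V -> V) bounded_linear_pred
    bounded_linear_zmod_closed.
HB.instance Definition _ := [SubChoice_isSubZmodule of bop by <:].

Lemma bounded_linear_id : (id : V -> V) \in bounded_linear_pred.
Proof.
by apply/asboolP; split=> //; exists 1 => x; rewrite mul1r.
Qed.

Lemma bounded_linear_comp (f g : bop) : f \o g \in bounded_linear_pred.
Proof.
have [[lf [M fM]] [lg [N gN]]] := (bopP f, bopP g).
apply/asboolP; split=> [a x y|] /=; first by rewrite lg lf.
exists (`|M| * N) => x /=.
have fM' y : `|f y| <= `|M| * `|y|.
  have M0 : 0 <= M * `|y| := le_trans (normr_ge0 _) (fM y).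
  by rewrite -(normr_id y) -normrM (ger0_norm M0).
by apply: le_trans (fM' _) _; rewrite -mulrA ler_wpM2l.
Qed.

Definition bop_one : bop := Bop bounded_linear_id.
Definition bop_mul (f g : bop) : bop := Bop (bounded_linear_comp f g).

Let bop_mulA : associative bop_mul.
Proof. by move=> f g h; apply: bop_ext. Qed.
Let bop_mul1l : left_id bop_one bop_mul.
Proof. by move=> f; apply: bop_ext. Qed.
Let bop_mul1r : right_id bop_one bop_mul.
Proof. by move=> f; apply: bop_ext. Qed.
Let bop_mulDl : left_distributive bop_mul +%R.
Proof. by move=> f g h; apply: bop_ext. Qed.
Let bop_mulDr : right_distributive bop_mul +%R.
Proof. by move=> f g h; apply: bop_ext => x; exact: bopD. Qed.

(* Only a pzRingType, since V may be the zero space. *)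
HB.instance Definition _ := GRing.Zmodule_isPzRing.Build bop
  bop_mulA bop_mul1l bop_mul1r bop_mulDl bop_mulDr.

End BoundedOperators.

Definition infinite_dimensional (K : pzRingType) (V : lmodType K) : Prop :=
  ~ exists (n : nat) (v : 'I_n -> V), forall x : V,
      exists c : 'I_n -> K, x = \sum_(i < n) c i *: v i.

Section ElementaryOperators.
Context (E : pzRingType).

Definition cross_commuting (k l : nat) (A : k.-tuple E) (S : l.-tuple E) :=
  forall (i : 'I_k) (j : 'I_l),
    tnth A i * tnth S j = tnth S j * tnth A i.

Definition commuting_tuple (k : nat) (A : k.-tuple E) := cross_commuting A A.

Definition triangle (k : nat) (A B : k.-tuple E) (X : E) : E :=
  X - \sum_(i < k) tnth A i * X * tnth B i.

Definition delta (k : nat) (A B : k.-tuple E) (X : E) : E :=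
  (\sum_(i < k) tnth A i) * X - X * (\sum_(i < k) tnth B i).

(* [allpairs] is row-major: s_1 a_1, ..., s_1 a_l, s_2 a_1, ..., s_k a_l. *)
Definition tuple_mul (k l : nat) (S : k.-tuple E) (A : l.-tuple E) :
    (k * l).-tuple E :=
  [tuple of allpairs *%R S A].

End ElementaryOperators.

(* Main.v *)
From HB Require Import structures.
Require Import Defs.
From mathcomp Require Import all_boot all_order all_algebra.
From mathcomp Require Import reals normedtype.

(** Let P, Q be the maps x |-> sum A_i x B_i and x |-> sum S_j x T_j, and let
    a, b, s, t be the sums of the tuples A, B, S, T.  By commutativity the map
    attached to (SA, TB) is PQ, and the sums of SA and TB are sa and tb, whence
      1 - PQ = (1 - P) + P(1 - Q),
      (sa)x - x(tb) = s(ax - xb) + (sx - xt)b.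
    Each of the two operators of the theorem is thus of the form pf + qg, where
    p and q commute with f and g, and fg = gf; if f^n and g^s kill x, then so
    does (pf + qg)^(n+s-1).  This is applied first to the deltas, then to the
    triangles. *)

Set Implicit Arguments.
Unset Strict Implicit.
Unset Printing Implicit Defensive.

Import GRing.Theory.
Local Open Scope ring_scope.

(** * Iterates of commuting additive maps *)

Lemma iter_swap (T : Type) (f g : T -> T) (n : nat) :
  (forall x, f (g x) = g (f x)) ->
  forall x, iter n f (g x) = g (iter n f x).
Proof. by move=> fg x; elim: n => //= n ->. Qed.

Lemma iter_raddf0 (M : zmodType) (f : {additive M -> M}) (n : nat) :
  iter n f 0 = 0.
Proof. by elim: n => //= n ->; rewrite raddf0. Qed.

Lemma iter_raddfD (M : zmodType) (f : {additive M -> M}) (n : nat) :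
  {morph iter n f : x y / x + y}.
Proof. by move=> x y; elim: n => //= n ->; rewrite raddfD. Qed.

(** Induction on [n + s]: one application of [u] splits [x] into [p (f x)], for which the exponent
    of [f] drops by one, and [q (g x)], for which that of [g] does. If [n] or [s] is 0, then [x]
    itself is 0, so the truncated subtraction does no harm. *)
Lemma iter_add_nilpotent (M : zmodType) (f g p q u : {additive M -> M})
    (n s : nat) (x : M) :
  (forall y, u y = p (f y) + q (g y)) ->
  (forall y, f (g y) = g (f y)) ->
  (forall y, f (p y) = p (f y)) -> (forall y, g (p y) = p (g y)) ->
  (forall y, f (q y) = q (f y)) -> (forall y, g (q y) = q (g y)) ->
  iter n f x = 0 -> iter s g x = 0 -> iter (n + s - 1) u x = 0.
Proof.
move=> uE fg fp gp fq gq.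
have gf y : g (f y) = f (g y) by [].
(* The exponents and the point all change from step to step, so they are generalised with only the
   sum fixed. *)
elim: {n s}(n + s)%N {-2}n {-2}s (erefl (n + s)%N) x => [|N IHN] [|n] [|s] //.
- by move=> _ x /= -> _; rewrite iter_raddf0.
- by move=> _ x /= _ ->; rewrite iter_raddf0.
move=> [nsN] x fx gx.
rewrite addSn subn1 /= addnS iterSr uE iter_raddfD.
have -> : iter (n + s) u (p (f x)) = 0.
  (* The exponent takes the shape of the induction hypothesis for the pair [n], [s.+1]. *)
  rewrite (_ : n + s = n + s.+1 - 1)%N; last by rewrite addnS subn1.
  apply: IHN => //.
    by rewrite (iter_swap _ fp) -iterSr fx raddf0.
  by rewrite (iter_swap _ gp) (iter_swap _ gf) gx !raddf0.
have -> : iter (n + s) u (q (g x)) = 0.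
  rewrite (_ : n + s = n.+1 + s - 1)%N; last by rewrite addSn subn1.
  apply: IHN; first by rewrite addSnnS.
    by rewrite (iter_swap _ fq) (iter_swap _ fg) fx !raddf0.
  by rewrite (iter_swap _ gq) -iterSr gx raddf0.
by rewrite addr0.
Qed.

(** * Sums over product tuples *)

Section ElementaryOperators.
Context (E : pzRingType).

Definition elementary (k : nat) (A B : k.-tuple E) (X : E) : E :=
  \sum_(i < k) tnth A i * X * tnth B i.

Definition tuple_sum (k : nat) (A : k.-tuple E) : E := \sum_(i < k) tnth A i.

(** Follows the row-major order of [tuple_mul], so that a position in a product tuple is decoded by
    lookup rather than by division with remainder. *)
Definition pair_tuple (k l : nat) : (k * l).-tuple ('I_k * 'I_l) :=
  [tuple of allpairs pair (ord_tuple k) (ord_tuple l)].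

Lemma tnth_tuple_mul (k l : nat) (S : k.-tuple E) (A : l.-tuple E)
    (q : 'I_(k * l)) :
  tnth (tuple_mul S A) q =
  tnth S (tnth (pair_tuple k l) q).1 * tnth A (tnth (pair_tuple k l) q).2.
Proof.
rewrite -(tnth_map (fun c => tnth S c.1 * tnth A c.2)); congr tnth.
apply: val_inj; rewrite /= map_allpairs /=.
(* With [S] and [A] written as images of their index enumerations, the maps are absorbed into the
   function of [allpairs]. *)
rewrite -[in LHS](map_tnth_enum S) -[in LHS](map_tnth_enum A).
by rewrite allpairs_mapl allpairs_mapr.
Qed.

(** A general [F] covers both the terms of [elementary] and plain sums of entries. *)
Lemma sum_tuple_mul (M : nmodType) (k l : nat) (F : E -> E -> M)
    (S T : k.-tuple E) (A B : l.-tuple E) :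
  \sum_(q < k * l) F (tnth (tuple_mul S A) q) (tnth (tuple_mul T B) q) =
  \sum_(i < k) \sum_(j < l) F (tnth S i * tnth A j) (tnth T i * tnth B j).
Proof.
under eq_bigr do rewrite !tnth_tuple_mul.
rewrite -(big_tuple _ _ (pair_tuple k l) xpredT
  (fun c => F (tnth S c.1 * tnth A c.2) (tnth T c.1 * tnth B c.2))).
by rewrite big_allpairs big_enum; apply: eq_bigr => i _; rewrite big_enum.
Qed.

Lemma tuple_sum_mul (k l : nat) (S : k.-tuple E) (A : l.-tuple E) :
  tuple_sum (tuple_mul S A) = tuple_sum S * tuple_sum A.
Proof.
rewrite /tuple_sum (sum_tuple_mul (fun x _ => x) S S A A) mulr_suml.
by apply: eq_bigr => i _; rewrite mulr_sumr.
Qed.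

(** Swapping the left factors of S_i A_j X T_i B_j gives A_j (S_i X T_i) B_j, with the right factors
    already nested. *)
Lemma elementary_mul (k l : nat) (S T : k.-tuple E) (A B : l.-tuple E) (X : E) :
  cross_commuting A S ->
  elementary (tuple_mul S A) (tuple_mul T B) X =
  elementary A B (elementary S T X).
Proof.
move=> AS; rewrite /elementary (sum_tuple_mul (fun x y => x * X * y)).
rewrite exchange_big; apply: eq_bigr => j _ /=.
rewrite mulr_sumr mulr_suml; apply: eq_bigr => i _.
by rewrite -AS !mulrA.
Qed.

(** * Additivity of the operators *)

Lemma elementary_is_zmod_morphism (k : nat) (A B : k.-tuple E) :
  zmod_morphism (elementary A B).
Proof.
move=> x y; rewrite /elementary -sumrB; apply: eq_bigr => i _.
by rewrite mulrBr mulrBl.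
Qed.
HB.instance Definition _ (k : nat) (A B : k.-tuple E) :=
  GRing.isZmodMorphism.Build E E (elementary A B)
    (elementary_is_zmod_morphism A B).

Lemma triangleE (k : nat) (A B : k.-tuple E) (X : E) :
  triangle A B X = X - elementary A B X.
Proof. by []. Qed.

Lemma triangle_is_zmod_morphism (k : nat) (A B : k.-tuple E) :
  zmod_morphism (triangle A B).
Proof. by move=> x y; rewrite !triangleE raddfB !opprD addrACA. Qed.
HB.instance Definition _ (k : nat) (A B : k.-tuple E) :=
  GRing.isZmodMorphism.Build E E (triangle A B)
    (triangle_is_zmod_morphism A B).

Lemma deltaE (k : nat) (A B : k.-tuple E) (X : E) :
  delta A B X = tuple_sum A * X - X * tuple_sum B.
Proof. by []. Qed.

Lemma delta_is_zmod_morphism (k : nat) (A B : k.-tuple E) :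
  zmod_morphism (delta A B).
Proof. by move=> x y; rewrite !deltaE mulrBr mulrBl !opprD addrACA. Qed.
HB.instance Definition _ (k : nat) (A B : k.-tuple E) :=
  GRing.isZmodMorphism.Build E E (delta A B) (delta_is_zmod_morphism A B).


(** The two-sided form serves for the terms S_j X T_j and, with [u] or [v] equal to 1, for one-sided
    multiplications. *)
Lemma triangle_mul (k : nat) (A B : k.-tuple E) (u v X : E) :
  (forall i, GRing.comm (tnth A i) u) -> (forall i, GRing.comm (tnth B i) v) ->
  triangle A B (u * X * v) = u * triangle A B X * v.
Proof.
move=> Au Bv; rewrite /triangle mulrBr mulrBl; congr (_ - _).
rewrite mulr_sumr mulr_suml; apply: eq_bigr => i _.
by rewrite !mulrA Au -!mulrA Bv.
Qed.

Lemma delta_mul (k : nat) (A B : k.-tuple E) (u v X : E) :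
  GRing.comm (tuple_sum A) u -> GRing.comm (tuple_sum B) v ->
  delta A B (u * X * v) = u * delta A B X * v.
Proof.
by move=> au bv; rewrite !deltaE mulrBr mulrBl !mulrA au -!mulrA bv.
Qed.

Lemma raddf_triangle (k : nat) (A B : k.-tuple E) (f : {additive E -> E})
    (X : E) :
  (forall i Y, f (tnth A i * Y * tnth B i) = tnth A i * f Y * tnth B i) ->
  f (triangle A B X) = triangle A B (f X).
Proof.
by move=> fAB; rewrite /triangle raddfB raddf_sum; under eq_bigr do rewrite fAB.
Qed.

Lemma raddf_delta (k : nat) (A B : k.-tuple E) (f : {additive E -> E}) (X : E) :
  (forall Y, f (tuple_sum A * Y) = tuple_sum A * f Y) ->
  (forall Y, f (Y * tuple_sum B) = f Y * tuple_sum B) ->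
  f (delta A B X) = delta A B (f X).
Proof. by move=> fA fB; rewrite !deltaE raddfB /= fA fB. Qed.

(** * Commutation of tuples with sums and products of tuples *)

Lemma comm_tuple_sum (k : nat) (A : k.-tuple E) (u : E) :
  (forall i, GRing.comm u (tnth A i)) -> GRing.comm u (tuple_sum A).
Proof. by move=> uA; apply: commr_sum. Qed.

Lemma cross_commuting_sym (k l : nat) (A : k.-tuple E) (S : l.-tuple E) :
  cross_commuting A S -> cross_commuting S A.
Proof. by move=> AS j i; rewrite AS. Qed.

Lemma cross_commuting_sumr (k l : nat) (A : k.-tuple E) (S : l.-tuple E) i :
  cross_commuting A S -> GRing.comm (tnth A i) (tuple_sum S).
Proof. by move=> AS; apply: comm_tuple_sum => j; apply: AS. Qed.

Lemma cross_commuting_sum (k l : nat) (A : k.-tuple E) (S : l.-tuple E) :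
  cross_commuting A S -> GRing.comm (tuple_sum A) (tuple_sum S).
Proof.
move=> AS; apply: commr_sym; apply: comm_tuple_sum => i.
by apply: commr_sym; apply: cross_commuting_sumr.
Qed.

Lemma cross_commuting_mul (j k l : nat) (C : j.-tuple E) (S : k.-tuple E)
    (A : l.-tuple E) :
  cross_commuting C S -> cross_commuting C A ->
  cross_commuting C (tuple_mul S A).
Proof. by move=> CS CA i q; rewrite tnth_tuple_mul; apply: commrM. Qed.

(** * Operators of two pairs of tuples *)

Section Commutation.
Context (k l : nat) (A B : k.-tuple E) (S T : l.-tuple E).
Hypotheses (AS : cross_commuting A S) (BT : cross_commuting B T).

Lemma triangle_triangle (X : E) :
  triangle A B (triangle S T X) = triangle S T (triangle A B X).
Proof.
by apply: raddf_triangle => j Y; apply: triangle_mul => i; [apply: AS | apply: BT].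
Qed.

Lemma triangle_suml (X : E) :
  triangle A B (tuple_sum S * X) = tuple_sum S * triangle A B X.
Proof.
(* A right factor 1 is inserted to match the two-sided lemma. *)
rewrite -[tuple_sum S * X]mulr1 triangle_mul ?mulr1 // => i.
  exact: cross_commuting_sumr.
exact: commr1.
Qed.

Lemma triangle_sumr (X : E) :
  triangle A B (X * tuple_sum T) = triangle A B X * tuple_sum T.
Proof.
rewrite -[X in X * _]mul1r triangle_mul ?mul1r // => i.
  exact: commr1.
exact: cross_commuting_sumr.
Qed.

Lemma triangle_delta (X : E) :
  triangle A B (delta S T X) = delta S T (triangle A B X).
Proof. by apply: raddf_delta => Y; [apply: triangle_suml | apply: triangle_sumr]. Qed.

Lemma delta_suml (X : E) :
  delta A B (tuple_sum S * X) = tuple_sum S * delta A B X.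
Proof.
rewrite -[tuple_sum S * X]mulr1 delta_mul ?mulr1 //; last exact: commr1.
exact: cross_commuting_sum.
Qed.

Lemma delta_sumr (X : E) :
  delta A B (X * tuple_sum T) = delta A B X * tuple_sum T.
Proof.
rewrite -[X in X * _]mul1r delta_mul ?mul1r //; first exact: commr1.
exact: cross_commuting_sum.
Qed.

Lemma delta_delta (X : E) : delta A B (delta S T X) = delta S T (delta A B X).
Proof. by apply: raddf_delta => Y; [apply: delta_suml | apply: delta_sumr]. Qed.

Lemma triangle_tuple_mul (X : E) :
  triangle (tuple_mul S A) (tuple_mul T B) X =
  triangle A B X + elementary A B (triangle S T X).
Proof.
by rewrite !triangleE elementary_mul // raddfB /= addrA subrK.
Qed.

Lemma delta_tuple_mul (X : E) :
  delta (tuple_mul S A) (tuple_mul T B) X =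
  tuple_sum S * delta A B X + delta S T X * tuple_sum B.
Proof.
by rewrite !deltaE !tuple_sum_mul mulrBr mulrBl !mulrA addrA subrK.
Qed.

End Commutation.

(** * Nilpotency for product tuples *)

Lemma iter_triangle_tuple_mul (k l : nat) (A B : k.-tuple E) (S T : l.-tuple E)
    (m r : nat) (X : E) :
  commuting_tuple A -> commuting_tuple B ->
  cross_commuting A S -> cross_commuting B T ->
  iter m (triangle A B) X = 0 -> iter r (triangle S T) X = 0 ->
  iter (m + r - 1) (triangle (tuple_mul S A) (tuple_mul T B)) X = 0.
Proof.
move=> AA BB AS BT.
have [SA TB] := (cross_commuting_sym AS, cross_commuting_sym BT).
(* In this form [elementary A B], which plays the part of [q], commutes with both triangles because
   they commute with [triangle A B]. *)
have elemE Y : elementary A B Y = Y - triangle A B Y by rewrite triangleE subKr.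
apply: (@iter_add_nilpotent _ (triangle A B) (triangle S T) idfun
  (elementary A B)) => //= Y.
- exact: triangle_tuple_mul.
- exact: triangle_triangle.
- by rewrite !elemE raddfB.
- by rewrite !elemE raddfB /= triangle_triangle.
Qed.

(** Here [p] is left multiplication by the sum of [S] and [q] right multiplication by the sum of
    [B]; they commute with both deltas since [S] commutes with [A] and [S], and [B] with [B] and
    [T]. *)
Lemma iter_delta_tuple_mul (k l : nat) (A B : k.-tuple E) (S T : l.-tuple E)
    (n s : nat) (X : E) :
  commuting_tuple B -> commuting_tuple S ->
  cross_commuting A S -> cross_commuting B T ->
  iter n (delta A B) X = 0 -> iter s (delta S T) X = 0 ->
  iter (n + s - 1) (delta (tuple_mul S A) (tuple_mul T B)) X = 0.
Proof.
move=> BB SS AS BT.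
have [SA TB] := (cross_commuting_sym AS, cross_commuting_sym BT).
apply: (@iter_add_nilpotent _ (delta A B) (delta S T)
  (tuple_sum S \*o idfun) (tuple_sum B \o* idfun)) => //= Y.
- exact: delta_tuple_mul.
- exact: delta_delta.
- exact: delta_suml.
- exact: delta_suml.
- exact: delta_sumr.
- exact: delta_sumr.
Qed.

End ElementaryOperators.

Theorem theorem4p1 (R : realType) (V : completeNormedModType R[i])
    (Vinf : infinite_dimensional V) (X : bop V)
    (d : nat) (d_gt0 : (0 < d)%N) (A B S T : d.-tuple (bop V))
    (Acomm : commuting_tuple A) (Bcomm : commuting_tuple B)
    (Scomm : commuting_tuple S) (Tcomm : commuting_tuple T)
    (AS : cross_commuting A S) (BS : cross_commuting B S)
    (BT : cross_commuting B T)
    (m n r s : nat)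
    (m_gt0 : (0 < m)%N) (n_gt0 : (0 < n)%N)
    (r_gt0 : (0 < r)%N) (s_gt0 : (0 < s)%N)
    (hAA : iter m (triangle A B) (iter n (delta A B) X) = 0)
    (hSS : iter r (triangle S T) (iter s (delta S T) X) = 0)
    (hSA : iter r (triangle S T) (iter n (delta A B) X) = 0)
    (hAS : iter m (triangle A B) (iter s (delta S T) X) = 0) :
  iter (m + r - 1) (triangle (tuple_mul S A) (tuple_mul T B))
    (iter (n + s - 1) (delta (tuple_mul S A) (tuple_mul T B)) X) = 0.

Proof.
have [SA TB] := (cross_commuting_sym AS, cross_commuting_sym BT).
(* Moves powers of the triangles of (A, B) and (S, T) inside the power of the product delta. *)
have triD (C D : d.-tuple (bop V)) (i : nat) Y :
    cross_commuting C A -> cross_commuting C S ->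
    cross_commuting D B -> cross_commuting D T ->
    iter i (triangle C D)
      (iter (n + s - 1) (delta (tuple_mul S A) (tuple_mul T B)) Y) =
    iter (n + s - 1) (delta (tuple_mul S A) (tuple_mul T B))
      (iter i (triangle C D) Y).
  move=> CA CS DB DT; apply: iter_swap => Z; symmetry; apply: iter_swap => {}Z.
  by symmetry; apply: triangle_delta; apply: cross_commuting_mul.
(* Turns the four hypotheses into statements that a power of a delta kills the image of [X] under a
   power of a triangle. *)
have swap (C D C' D' : d.-tuple (bop V)) (i j : nat) :
    cross_commuting C C' -> cross_commuting D D' ->
    iter i (triangle C D) (iter j (delta C' D') X) = 0 ->
    iter j (delta C' D') (iter i (triangle C D) X) = 0.
  move=> CC DD <-; apply: iter_swap => Z; symmetry; apply: iter_swap => {}Z.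
  exact: triangle_delta.
(* It remains that the [m]-th power of [triangle A B] and the [r]-th of [triangle S T] kill the
   image of [X] under the product delta power; each case uses two of the four hypotheses. *)
apply: iter_triangle_tuple_mul => //.
  rewrite triD //; apply: iter_delta_tuple_mul => //; exact: swap.
rewrite triD //; apply: iter_delta_tuple_mul => //; exact: swap.
Qed.
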